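(* Let $V\subset\mathbb{C}$ be a space and let $n\ge 3$ be an integer. Then $V$ contains a rational $n$-tuple if and only if $V$ contains an $n$-gon with rational angles and no pair of parallel sides.
   Context: Identify $\mathbb{R}^2$ with $\mathbb{C}$. A space is the $\mathbb{Q}$-span of two $\mathbb{R}$-linearly independent elements of $\mathbb{C}$ (equivalently, $\Lambda\otimes\mathbb{Q}$ for a rank-2 lattice $\Lambda\subset\mathbb{C}$). A rational angle in $V$ is a pair $(v_1,v_2)$ of $\mathbb{R}$-linearly independent elements of $V$ such that the argument of $v_1/v_2$ is a rational multiple of $\pi$. A rational $n$-tuple in $V$ is a set of $n$ elements of $V$ any two of which form a rational angle. An $n$-gon is a (non-self-crossing) polygon with $n$ vertices; it is contained in $V$ if all its vertices belong to $V$; it has rational angles if all its angles (at the vertices) are rational multiples of $\pi$. *)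

(* Defs.v *)
From mathcomp Require Import all_boot all_order all_algebra finmap.
From mathcomp Require Import all_classical all_reals all_analysis.
From mathcomp Require Export complex.

Set Implicit Arguments.
Unset Strict Implicit.
Unset Printing Implicit Defensive.
Import Order.TTheory GRing.Theory Num.Theory.

Local Open Scope classical_set_scope.
Local Open Scope ring_scope.
Local Open Scope complex_scope.

Definition R_independent (R : realType) (v w : R[i]) : Prop :=
  forall a b : R, a%:C * v + b%:C * w = 0 -> a = 0 /\ b = 0.

Definition is_space (R : realType) (V : set R[i]) : Prop :=
  exists w1 w2 : R[i], R_independent w1 w2 /\
    V = [set z : R[i] | exists a b : rat, z = ratr a * w1 + ratr b * w2].

(* Arguments are determined modulo 2 pi; 0 has none. *)
Definition is_argument (R : realType) (z : R[i]) (theta : R) : Prop :=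
  exists r : R, 0 < r /\ z = r%:C * (cos theta +i* sin theta).

Definition rational_argument (R : realType) (z : R[i]) : Prop :=
  exists q : rat, is_argument z (ratr q * pi).

Definition rational_angle (R : realType) (V : set R[i]) (v1 v2 : R[i]) : Prop :=
  [/\ V v1, V v2, R_independent v1 v2 & rational_argument (v1 / v2)].

Definition rational_tuple (R : realType) (V : set R[i]) (n : nat)
    (S : {fset R[i]}) : Prop :=
  [/\ [set` S] `<=` V, #|` S|%fset = n &
      forall v1 v2, v1 \in S -> v2 \in S -> v1 != v2 -> rational_angle V v1 v2].

(* A polygon is given by its vertices in cyclic order; the [i]-th side joins
   [p i] to its cyclic successor [p (ordS i)]. *)
Definition side (R : realType) (n : nat) (p : 'I_n -> R[i]) (i : 'I_n) : R[i] :=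
  p (ordS i) - p i.

(* Non-self-crossing: the closed path running once through all the sides, each
   taken without its final endpoint, is injective. *)
Definition simple_polygon (R : realType) (n : nat) (p : 'I_n -> R[i]) : Prop :=
  forall (i j : 'I_n) (s t : R), 0 <= s < 1 -> 0 <= t < 1 ->
    p i + s%:C * side p i = p j + t%:C * side p j -> i = j /\ s = t.

(* The argument is that of the interior angle or of its opposite modulo 2 pi,
   according to the orientation of the polygon. *)
Definition rational_angle_at (R : realType) (n : nat) (p : 'I_n -> R[i])
    (i : 'I_n) : Prop :=
  rational_argument ((p (ordS i) - p i) / (p (ord_pred i) - p i)).

(* Sides lying on a common line count as parallel. *)
Definition no_parallel_sides (R : realType) (n : nat) (p : 'I_n -> R[i]) : Prop :=
  forall i j : 'I_n, i != j -> R_independent (side p i) (side p j).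

(* Main.v *)
Require Import Defs.
From mathcomp Require Import all_boot all_order all_algebra finmap.
From mathcomp Require Import all_classical all_reals all_analysis.
From mathcomp Require Import ring lra zify.

(** The sides of a polygon add up to zero, and an interior angle is, up to a
    half turn, the angle between two consecutive sides. If the polygon has
    rational angles and pairwise independent sides, the quotient of any two
    sides telescopes along the boundary into a product of rational angles, so
    the sides themselves form a rational tuple ([tuple_of_polygon]).

    Conversely, replacing the vectors of a rational tuple by nonzero rational
    multiples keeps every angle rational, because rotating by a half turn does.
    It is thus enough to find nonzero rationals [q v] and an order on the tuple
    for which the path with steps [q v * v] closes up without crossing itself.
    Pick a vector [v0] of the tuple as the direction of the closing side, and
    give the plane rational coordinates [(x, y)] in which [v0 = (1, 0)]. The
    other vectors are not horizontal, and as n >= 3 there are at least two of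
    them; by independence their values of [x / y] are distinct. A rational shear
    [x := x - c y], with [c] strictly between two of these values and different
    from all of them, makes every [x] nonzero and makes both signs of [x / y]
    occur. The weights can then be chosen so that all steps go rightwards, the
    descending ones total -1 in height, and the ascending ones total +1
    ([balanced_weights]). Taking the descending steps first gives an x-monotone
    chain that starts and ends at height 0 and stays strictly below it in
    between; it is closed by a horizontal segment, a nonzero rational multiple
    of [v0]. Such a polygon is simple ([simple_polygon_over_chord]): the chain
    meets every vertical line at most once and touches the closing side only at
    its ends. *)

Set Implicit Arguments.
Unset Strict Implicit.
Unset Printing Implicit Defensive.
Import Order.TTheory GRing.Theory Num.Theory.
Local Open Scope ring_scope.
Local Open Scope complex_scope.

(** * The area form and linear independence *)

(** The determinant of [z] and [w] as plane vectors. With one argument fixed and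
    the other varying it runs over all real linear forms on the plane, and this
    is how coordinates are expressed below. *)
Definition cross (R : realType) (z w : R[i]) : R :=
  complex.Re z * complex.Im w - complex.Im z * complex.Re w.

Lemma crossD (R : realType) (u z w : R[i]) :
  cross u (z + w) = cross u z + cross u w.
Proof. by rewrite /cross !raddfD /=; ring. Qed.

Lemma crossZ (R : realType) (u z : R[i]) (a : R) :
  cross u (a%:C * z) = a * cross u z.
Proof. by rewrite /cross; case: u z => [? ?] [? ?] /=; ring. Qed.

Lemma crossZl (R : realType) (u z : R[i]) (a : R) :
  cross (a%:C * u) z = a * cross u z.
Proof. by rewrite /cross; case: u z => [? ?] [? ?] /=; ring. Qed.

Lemma crossDl (R : realType) (u z w : R[i]) :
  cross (u + z) w = cross u w + cross z w.
Proof. by rewrite /cross !raddfD /=; ring. Qed.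

Lemma crossvv (R : realType) (u : R[i]) : cross u u = 0.
Proof. by rewrite /cross; ring. Qed.

Lemma cross_sum (R : realType) (u : R[i]) (e : seq R[i]) :
  cross u (\sum_(x <- e) x) = \sum_(x <- e) cross u x.
Proof.
by apply: (big_morph (cross u) (crossD u)); rewrite /cross /= !mulr0 subrr.
Qed.

Lemma ratr_complex (R : realType) (a : rat) :
  ratr a = (ratr a : R)%:C :> R[i].
Proof. by rewrite fmorph_rat. Qed.

(** If the determinant vanishes, the relations with coefficients [Re w],
    [- Re z] and [Im w], [- Im z] both hold, so independence would force
    [z = w = 0]. *)
Lemma R_independentP (R : realType) (z w : R[i]) :
  R_independent z w <-> cross z w != 0.
Proof.
rewrite /cross; split; last first.
  case: z w => [a b] [c d] /= D0 x y /eqP.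
  rewrite eq_complex /= !mul0r !subr0 !addr0 => /andP[/eqP E1 /eqP E2].
  split; apply: (mulIf D0); rewrite mul0r.
    by transitivity ((x * a + y * c) * d - (x * b + y * d) * c);
      [ring | rewrite E1 E2; ring].
  by transitivity ((x * b + y * d) * a - (x * a + y * c) * b);
    [ring | rewrite E1 E2; ring].
move=> ind; apply/eqP => D0.
have [] := ind (complex.Re w) (- complex.Re z).
  case: z w D0 {ind} => [a b] [c d] /= D0; apply/eqP; rewrite eq_complex /=.
  by apply/andP; split; apply/eqP; [ring | lra].
have [] := ind (complex.Im w) (- complex.Im z).
  case: z w D0 {ind} => [a b] [c d] /= D0; apply/eqP; rewrite eq_complex /=.
  by apply/andP; split; apply/eqP; [lra | ring].
case: z w ind {D0} => [a b] [c d] /= ind _ /eqP; rewrite oppr_eq0 => /eqP b0.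
move=> _ /eqP; rewrite oppr_eq0 => /eqP a0; have [] := ind 1 0.
  rewrite a0 b0; apply/eqP.
  by rewrite eq_complex /= !mulr0 !mul0r !subr0 !addr0 eqxx.
by move/eqP; rewrite oner_eq0.
Qed.

Lemma R_independentZ (R : realType) (z w : R[i]) (a b : R) :
  a != 0 -> b != 0 -> R_independent z w ->
  R_independent (a%:C * z) (b%:C * w).
Proof.
by rewrite !R_independentP crossZ crossZl => *; rewrite !mulf_neq0.
Qed.

Lemma R_independent_neq (R : realType) (z w : R[i]) :
  R_independent z w -> z != w.
Proof.
by rewrite R_independentP; apply: contraNneq => ->; rewrite crossvv.
Qed.

Lemma R_independent_neq0 (R : realType) (z w : R[i]) :
  R_independent z w -> z != 0.
Proof.
rewrite R_independentP; apply: contraNneq => ->.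
by rewrite /cross !mul0r subrr.
Qed.

(** * Complex numbers with rational argument *)

Lemma rational_argumentM (R : realType) (z w : R[i]) :
  rational_argument z -> rational_argument w -> rational_argument (z * w).
Proof.
move=> [a [r [r0 ->]]] [b [s [s0 ->]]]; exists (a + b), (r * s); split.
  exact: mulr_gt0.
rewrite rmorphD /= mulrDl cosD sinD; apply/eqP; rewrite eq_complex /=.
by apply/andP; split; apply/eqP; ring.
Qed.

Lemma rational_argumentV (R : realType) (z : R[i]) :
  rational_argument z -> rational_argument z^-1.
Proof.
move=> [a [r [r0 ->]]]; exists (- a), r^-1; split; first by rewrite invr_gt0.
rewrite rmorphN /= mulNr cosN sinN.
set t := ratr a * pi; have c2 := cos2Dsin2 t.
have E : r%:C * (cos t +i* sin t) * (r^-1%:C * (cos t +i* - sin t)) = 1.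
  apply/eqP; rewrite eq_complex /=; apply/andP; split; apply/eqP; last by ring.
  rewrite -c2; field; exact: lt0r_neq0.
have U : r%:C * (cos t +i* sin t) != 0.
  by apply: contra_eq_neq E => ->; rewrite mul0r eq_sym oner_eq0.
by apply: (mulfI U); rewrite E mulfV.
Qed.

(** Negative rationals have argument [pi], so signs are free. *)
Lemma rational_argument_ratr (R : realType) (a : rat) :
  a != 0 -> rational_argument (ratr a : R[i]).
Proof.
rewrite neq_lt ratr_complex => /orP[a0|a0].
  exists 1, (- ratr a); split; first by rewrite oppr_gt0 ltrq0.
  rewrite rmorph1 mul1r cospi sinpi; apply/eqP; rewrite eq_complex /=.
  by apply/andP; split; apply/eqP; ring.
exists 0, (ratr a); split; first by rewrite ltr0q.
by rewrite rmorph0 mul0r cos0 sin0 mulr1.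
Qed.

Lemma rational_argumentZ (R : realType) (a : rat) (z : R[i]) :
  a != 0 -> rational_argument z -> rational_argument (ratr a * z).
Proof. by move=> /(@rational_argument_ratr R)/rational_argumentM; apply. Qed.

Lemma rational_argumentN (R : realType) (z : R[i]) :
  rational_argument z -> rational_argument (- z).
Proof.
move=> /(@rational_argumentZ _ (- 1)).
by rewrite rmorphN rmorph1 mulN1r oppr_eq0 oner_eq0; apply.
Qed.

(** * Choice of the shear and of the weights *)

Lemma between_avoiding (F : realFieldType) (a b : F) (s : seq F) :
  a < b -> exists c, [/\ a < c, c < b & c \notin s].
Proof.
move=> ab; suff [c [ac cb H]] : exists c, [/\ a < c, c < b &
    forall r, r \in s -> r <= a \/ c < r].
  exists c; split=> //; apply/negP => /H[|]; last by rewrite ltxx.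
  by rewrite leNgt ac.
(* Staying below every element of [s] that exceeds [a] is easier to maintain
   along the list than mere avoidance. *)
elim: s => [|x s [c [ac cb H]]].
  by exists ((a + b) / 2); split=> //; lra.
have [xa|ax] := leP x a.
  by exists c; split=> // r; rewrite inE => /predU1P[->|/H//]; left.
exists (Num.min c ((a + x) / 2)); split.
- by rewrite lt_min ac; lra.
- by rewrite gt_min cb.
- move=> r; rewrite inE => /predU1P[->|/H[|cr]]; [right|by left|right].
    by rewrite gt_min; apply/orP; right; lra.
  by rewrite gt_min cr.
Qed.

(** Here [(a v, b v)] are the coordinates of [v] and [c] is the shear. A vector
    whose sheared inverse slope [a v / b v - c] is negative gets height
    [q v * b v = -1/k] and one with positive inverse slope gets [1/l], where [k]
    and [l] count the vectors of either kind. The heights then cancel, and each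
    abscissa, being height times inverse slope, is positive. *)
Lemma balanced_weights (F : realFieldType) (T : eqType) (s : seq T)
    (a b : T -> F) (x y : T) :
    {in s, forall v, b v != 0} -> x \in s -> y \in s -> a x / b x < a y / b y ->
  exists c (q : T -> F) s1 s2,
  [/\ perm_eq (s1 ++ s2) s, {in s, forall v, 0 < q v * (a v - c * b v)},
      {in s1, forall v, q v * b v < 0}, {in s2, forall v, 0 < q v * b v} &
      \sum_(v <- s1 ++ s2) q v * b v = 0].
Proof.
move=> b0 xs ys xy.
have [c [xc cy cs]] := between_avoiding [seq a v / b v | v <- s] xy.
pose neg := [pred v | a v / b v < c].
pose s1 := [seq v <- s | neg v]; pose s2 := [seq v <- s | predC neg v].
have s1_gt0 : 0 < (size s1)%:R :> F.
  by rewrite ltr0n size_filter -has_count; apply/hasP; exists x.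
have s2_gt0 : 0 < (size s2)%:R :> F.
  rewrite ltr0n size_filter -has_count; apply/hasP; exists y => //=.
  by rewrite -leNgt ltW.
pose q v := if neg v then - ((size s1)%:R * b v)^-1
            else ((size s2)%:R * b v)^-1.
have q1 v : v \in s1 -> q v * b v = - (size s1)%:R^-1.
  rewrite mem_filter => /andP[vn vs]; rewrite /q vn invfM mulNr -mulrA.
  by rewrite mulVf ?mulr1 // b0.
have q2 v : v \in s2 -> q v * b v = (size s2)%:R^-1.
  rewrite mem_filter => /andP[vn vs]; rewrite /q ifN // invfM -mulrA.
  by rewrite mulVf ?mulr1 // b0.
exists c, q, s1, s2; split.
- by rewrite /s1 /s2 perm_filterC.
- move=> v vs; have /= vb := b0 v vs.
  have -> : q v * (a v - c * b v) = (q v * b v) * (a v / b v - c) by field.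
  have [vn|vn] := boolP (neg v).
    rewrite q1 ?mem_filter ?vn // mulNr -mulrN mulr_gt0 ?invr_gt0 // oppr_gt0.
    by rewrite subr_lt0.
  rewrite q2 ?mem_filter /= ?vn // mulr_gt0 ?invr_gt0 // subr_gt0.
  rewrite lt_neqAle leNgt vn andbT; apply: contra cs => /eqP ->.
  exact: map_f.
- by move=> v /q1 ->; rewrite oppr_lt0 invr_gt0.
- by move=> v /q2 ->; rewrite invr_gt0.
- rewrite big_cat /= (eq_big_seq _ q1) (eq_big_seq _ q2).
  rewrite !big_const_seq !iter_addr_0 !count_predT mulNrn.
  rewrite -(mulr_natr _^-1 (size s1)) -(mulr_natr _^-1 (size s2)).
  by rewrite !mulVf ?gt_eqF // addNr.
Qed.

(** * Rational coordinates in a space *)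

Lemma space_subspace (R : realType) (V : set R[i]) (z w : R[i]) (a b : rat) :
  is_space V -> V z -> V w -> V (ratr a * z + ratr b * w).
Proof.
move=> [w1 [w2 [_ ->]]] [z1 [z2 ->]] [y1 [y2 ->]].
exists (a * z1 + b * y1), (a * z2 + b * y2).
by rewrite !rmorphD !rmorphM /=; ring.
Qed.

Lemma space_sum (R : realType) (V : set R[i]) (s : seq R[i]) :
  is_space V -> {in s, forall z, V z} -> V (\sum_(z <- s) z).
Proof.
move=> hV; elim: s => [|z s IH] Vs.
  rewrite big_nil; case: hV => w1 [w2 [_ ->]].
  by exists 0, 0; rewrite rmorph0 !mul0r addr0.
rewrite big_cons -[z]mul1r -[X in _ + X]mul1r -(rmorph1 ratr).
apply: space_subspace => //; first by apply: Vs; rewrite mem_head.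
by apply: IH => w ws; apply: Vs; rewrite inE ws orbT.
Qed.

Lemma space_coordinates (R : realType) (V : set R[i]) (z w : R[i]) :
    is_space V -> V z -> V w -> R_independent z w ->
  forall v, V v -> exists a b : rat, v = ratr a * z + ratr b * w.
Proof.
move=> [w1 [w2 [_ ->]]] [a0 [b0 ->]] [a1 [b1 ->]] /R_independentP D0.
move=> v [a [b ->]].
have d0 : a0 * b1 - a1 * b0 != 0.
  apply: contra D0 => /eqP d0.
  rewrite !ratr_complex !crossD !crossDl !crossZ !crossZl !crossvv.
  have -> : cross w2 w1 = - cross w1 w2 by rewrite /cross; ring.
  move/(congr1 (@ratr R)): d0; rewrite rmorph0 rmorphB !rmorphM /= => d0.
  move/(congr1 ( *%R^~ (cross w1 w2))): d0; rewrite mul0r => d0.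
  by apply/eqP; apply: etrans d0; ring.
exists ((a * b1 - a1 * b) / (a0 * b1 - a1 * b0)).
exists ((a0 * b - a * b0) / (a0 * b1 - a1 * b0)).
set A := (_ / _); set B := (_ / _).
transitivity (ratr (A * a0 + B * a1) * w1 + ratr (A * b0 + B * b1) * w2).
  by congr (ratr _ * _ + ratr _ * _); rewrite /A /B; field.
by rewrite !rmorphD !rmorphM /=; ring.
Qed.

(** * Simplicity of a chain closed by a chord *)

(** [cross u] is the abscissa and [cross w] the height. Distinct sides of the
    chain project to disjoint half-open intervals of abscissae. The closing side
    has height 0, which a side of the chain, taken without its final endpoint,
    attains only at the first vertex; but that is the excluded endpoint of the
    closing side. *)
Lemma simple_polygon_over_chord (R : realType) (m : nat)
    (p : 'I_m.+3 -> R[i]) (u w : R[i]) :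
    (forall i j : 'I_m.+3, (i < j)%N -> cross u (p i) < cross u (p j)) ->
    (forall i : 'I_m.+3, (0 < i < m.+2)%N -> cross w (p i) < 0) ->
    cross w (p ord0) = 0 -> cross w (p ord_max) = 0 ->
  simple_polygon p.
Proof.
set X := fun i => cross u (p i); set Y := fun i => cross w (p i).
rewrite -/(Y ord0) -/(Y ord_max) => Xlt Ylt0 Y0 Ymax.
have Smax : ordS (@ord_max m.+2) = ord0 by apply/val_inj; rewrite /= modnn.
have valS (i : 'I_m.+3) : i != ord_max -> ordS i = i.+1 :> nat.
  move=> imax; rewrite /= modn_small // ltnS ltn_neqAle -ltnS ltn_ord andbT.
  by rewrite -val_eqE in imax.
have XS (i : 'I_m.+3) : i != ord_max -> X i < X (ordS i).
  by move=> im; apply: Xlt; rewrite valS.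
have Yle0 i : Y i <= 0.
  have [->|i0] := eqVneq i ord0; first by rewrite Y0.
  have [->|im] := eqVneq i ord_max; first by rewrite Ymax.
  rewrite ltW // Ylt0 // lt0n -[0%N]/(val (@ord0 m.+2)) val_eqE i0 /=.
  by move: (ltn_ord (ordS i)); rewrite (valS _ im).
have crossE v i s : cross v (p i + s%:C * side p i) =
    (1 - s) * cross v (p i) + s * cross v (p (ordS i)).
  rewrite /side crossD crossZ crossD.
  have -> : cross v (- p i) = - cross v (p i).
    by rewrite /cross !raddfN /=; ring.
  ring.
pose meet i j s t := (1 - s) * X i + s * X (ordS i) =
      (1 - t) * X j + t * X (ordS j) /\
    (1 - s) * Y i + s * Y (ordS i) = (1 - t) * Y j + t * Y (ordS j).
have no_meet (i j : 'I_m.+3) s t : 0 <= s < 1 -> 0 <= t < 1 -> (i < j)%N ->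
    meet i j s t -> False.
  move=> /andP[s0 s1] /andP[t0 t1] ij [EX EY].
  have im : i != ord_max by apply: contraTneq ij => ->; rewrite -leqNgt -ltnS.
  have := XS i im => XiS.
  have [jm|jm] := eqVneq j ord_max; last first.
    have XSj : X (ordS i) <= X j.
      have [lt||/val_inj->//] := ltngtP (ordS i) j; first exact/ltW/Xlt.
      by rewrite valS // ltnS leqNgt ij.
    have := XS j jm => XjS.
    have P1 : 0 < (1 - s) * (X (ordS i) - X i).
      by rewrite mulr_gt0 // subr_gt0.
    have P2 : 0 <= t * (X (ordS j) - X j) by rewrite mulr_ge0 // subr_ge0 ltW.
    lra.
  move: EX EY; rewrite jm Smax Y0 Ymax !mulr0 addr0 => EX EY.
  have N1 : 0 <= (1 - s) * - Y i by rewrite mulr_ge0 ?oppr_ge0 // subr_ge0 ltW.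
  have N2 : 0 <= s * - Y (ordS i) by rewrite mulr_ge0 ?oppr_ge0.
  have i0 : i = ord0.
    apply/eqP; apply: contraT => i0.
    suff : 0 < (1 - s) * - Y i by lra.
    rewrite mulr_gt0 ?subr_gt0 // oppr_gt0 Ylt0 // lt0n.
    rewrite -[0%N]/(val (@ord0 m.+2)) val_eqE i0 /=.
    by move: (ltn_ord (ordS i)); rewrite (valS _ im).
  have Xm0 : X ord0 < X ord_max by apply: Xlt.
  have s0' : s = 0.
    apply/eqP; apply: contraT => sn0.
    suff : 0 < s * - Y (ordS i) by lra.
    rewrite mulr_gt0 //; first by rewrite lt0r sn0.
    rewrite oppr_gt0 Ylt0 //.
    by rewrite (valS _ im) i0.
  move: EX; rewrite i0 s0' => EX.
  have P : 0 < (1 - t) * (X ord_max - X ord0) by rewrite mulr_gt0 // subr_gt0.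
  lra.
move=> i j s t s01 t01 E.
have M : meet i j s t by split; rewrite /X /Y -!crossE E.
have [ij|ij|/val_inj ij] := ltngtP i j.
- by case: (no_meet i j s t).
- by case: (no_meet j i t s) => //; case: M.
subst j; split=> //; have D : X (ordS i) - X i != 0.
  have [->|im] := eqVneq i ord_max.
    by rewrite Smax subr_eq0 lt_eqF // Xlt.
  by rewrite subr_eq0 gt_eqF // XS.
by apply: (mulIf D); case: M => M _; lra.
Qed.

Lemma sumr_gt0 (F : numDomainType) (T : eqType) (f : T -> F) (s : seq T) :
  (0 < size s)%N -> {in s, forall x, 0 < f x} -> 0 < \sum_(x <- s) f x.
Proof.
case: s => // x s _ H; rewrite big_cons ltr_pwDl ?H ?mem_head //.
by rewrite big_seq sumr_ge0 // => y ys; rewrite ltW // H // inE ys orbT.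
Qed.

(** This includes the last side, which returns to the empty partial sum: the
    partial sum before it is minus the last entry, as the total is zero. *)
Lemma side_psum (R : realType) (n : nat) (e : seq R[i]) (i : 'I_n) :
    size e = n -> \sum_(x <- e) x = 0 ->
  side (fun k : 'I_n => \sum_(x <- take k e) x) i = e`_i.
Proof.
move=> sz e0; rewrite /side /=.
have : \sum_(x <- take i.+1 e) x = \sum_(x <- take i e) x + e`_i.
  by rewrite (take_nth 0) ?sz // -cats1 big_cat big_seq1.
have [lt|ge] := ltnP i.+1 n; first by rewrite modn_small // => ->; ring.
have iE : i.+1 = n by apply/eqP; rewrite eqn_leq ge ltn_ord.
have -> : take i.+1 e = e by rewrite take_oversize // sz iE.
rewrite e0 => /eqP; rewrite eq_sym addrC addr_eq0 => /eqP ->.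
have -> : (i.+1 %% n = 0)%N by rewrite [X in (X %% _)%N]iE modnn.
by rewrite take0 big_nil sub0r.
Qed.

(** An interior vertex is below the chord: either it is reached by descending
    steps only, or the steps that remain before the horizontal one all ascend,
    back to height 0. *)
Lemma simple_polygon_psum (R : realType) (m : nat) (e1 e2 : seq R[i])
    (z u w : R[i]) (e := e1 ++ e2 ++ [:: z]) :
    size e = m.+3 -> \sum_(x <- e) x = 0 ->
    {in e1 ++ e2, forall x, 0 < cross u x} ->
    {in e1, forall x, cross w x < 0} -> {in e2, forall x, 0 < cross w x} ->
    cross w z = 0 ->
  simple_polygon (fun k : 'I_m.+3 => \sum_(x <- take k e) x).
Proof.
rewrite {}/e catA; set f := e1 ++ e2 => sz sum0 fu e1w e2w wz.
have szf : size f = m.+2 by move: sz; rewrite size_cat addn1 => -[].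
have takef (k : nat) : (k <= m.+2)%N -> take k (f ++ [:: z]) = take k f.
  rewrite -szf leq_eqVlt take_cat => /predU1P[->|->//].
  by rewrite ltnn subnn take0 cats0 take_size.
have fw : \sum_(x <- f) cross w x = 0.
  rewrite -cross_sum; have := congr1 (cross w) sum0.
  rewrite big_cat /= big_seq1 crossD wz addr0 => ->.
  by rewrite /cross /= !mulr0 subrr.
apply: (@simple_polygon_over_chord _ _ _ u w) => [i j ij|i /andP[i0 im]||].
- rewrite !takef; try by rewrite -ltnS ltn_ord.
  rewrite !cross_sum -[X in take j X](cat_take_drop i) take_cat size_take szf.
  have jm : (j <= m.+2)%N by rewrite -ltnS.
  rewrite (leq_trans ij jm) ltnNge (ltnW ij) /= big_cat /= ltrDl.
  apply: sumr_gt0 => [|x /mem_take /mem_drop /fu//].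
  by rewrite size_take size_drop szf; case: ifP => _; lia.
- rewrite takef ?(ltnW im) // cross_sum; have [i1|i1] := leqP i (size e1).
    rewrite takel_cat // -oppr_gt0 -sumrN; apply: sumr_gt0.
      by rewrite size_takel.
    by move=> x /mem_take /e1w; rewrite oppr_gt0.
  have := fw; rewrite -(cat_take_drop i f) big_cat cat_take_drop => /eqP.
  rewrite addr_eq0 => /eqP ->; rewrite oppr_lt0.
  apply: sumr_gt0; first by rewrite size_drop szf subn_gt0.
  move=> x; rewrite drop_cat ltnNge (ltnW i1) /= => /mem_drop; exact: e2w.
- by rewrite take0 cross_sum big_nil.
- by rewrite takef // -szf take_size cross_sum.
Qed.

(** * From tuples to polygons *)

(** The vector from a vertex back to its predecessor is minus a side, so the
    quotient at a vertex is a rational multiple of a quotient of two vectors of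
    the tuple; the sign of this multiple is harmless. *)
Lemma rational_angles_of_proportional_sides (R : realType) (n : nat)
    (s : seq R[i]) (q : R[i] -> rat) (p : 'I_n -> R[i]) :
    (1 < n)%N -> uniq s -> size s = n ->
    {in s &, forall v w, v != w ->
      R_independent v w /\ rational_argument (v / w)} ->
    {in s, forall v, q v != 0} ->
    (forall i : 'I_n, side p i = ratr (q s`_i) * s`_i) ->
  (forall i, rational_angle_at p i) /\ no_parallel_sides p.
Proof.
move=> n1 us sz rs q0 ps.
have sI (i : 'I_n) : s`_i \in s by rewrite mem_nth ?sz.
have sneq (i j : 'I_n) : i != j -> s`_i != s`_j.
  by move=> ij; rewrite nth_uniq ?sz.
split=> [i|i j ij].
  set k := ord_pred i.
  have ik : i != k.
    rewrite /k -val_eqE /=; case: (nat_of_ord i) (ltn_ord i) => [|j] jn.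
      by rewrite add0n modn_small; lia.
    by rewrite addSn /= modnDr modn_small; lia.
  have E : p k - p i = - side p k by rewrite /side /k ord_predK opprB.
  rewrite /rational_angle_at E -/(side p i) !ps invrN mulrN.
  have -> : ratr (q s`_i) * s`_i / (ratr (q s`_k) * s`_k) =
      ratr (q s`_i / q s`_k) * (s`_i / s`_k) :> R[i].
    by rewrite fmorph_div invfM mulrACA.
  apply/rational_argumentN/rational_argumentZ.
    by rewrite mulf_neq0 ?invr_eq0 ?q0.
  by have [] := rs _ _ (sI i) (sI k) (sneq _ _ ik).
rewrite !ps !ratr_complex; apply: R_independentZ; rewrite ?fmorph_eq0 ?q0 //.
by have [] := rs _ _ (sI i) (sI j) (sneq _ _ ij).
Qed.

(** The first entry of the tuple directs the closing side, and the next two have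
    different inverse slopes relative to it: in the basis formed by the first
    two, the inverse slope is 0 for the second and nonzero for the third. *)
Lemma polygon_of_tuple (R : realType) (V : set R[i]) (m : nat)
    (S : {fset R[i]}) :
    is_space V -> rational_tuple V m.+3 S ->
  exists p : 'I_m.+3 -> R[i],
    [/\ simple_polygon p, (forall i, V (p i)),
        (forall i, rational_angle_at p i) & no_parallel_sides p].
Proof.
move=> hV [SV cardS angS].
(* Only inclusion in [S] is kept, so that the list can be split into named
   entries without touching [S]. *)
have : exists s : seq R[i], [/\ uniq s, size s = m.+3 & {subset s <= S}].
  by exists (enum_fset S); split=> //; exact: fset_uniq.
move=> [[|v0 [|v1 [|v2 s']]] []] // us szs sS.
set s := v1 :: v2 :: s'.
have Vs v : v \in v0 :: s -> V v by move=> /sS vS; exact: SV.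
have ang v w : v \in v0 :: s -> w \in v0 :: s -> v != w ->
    R_independent v w /\ rational_argument (v / w).
  by move=> vs ws vw; have [] := angS v w (sS _ vs) (sS _ ws) vw.
have v0s : v0 \in v0 :: s by rewrite mem_head.
have v1s : v1 \in s by rewrite mem_head.
have v2s : v2 \in s by rewrite !inE eqxx orbT.
have sub v : v \in s -> v \in v0 :: s by move=> vs; rewrite in_cons vs orbT.
have s_neq v : v \in s -> v0 != v.
  by move: us => /= /andP[v0n _] vs; apply: contraNneq v0n => ->.
have i01 : R_independent v0 v1.
  by have [] := ang v0 v1 v0s (sub _ v1s) (s_neq _ v1s).
have D0 : cross v0 v1 != 0 by apply/R_independentP.
have coordE v : exists c : rat * rat, V v -> v = ratr c.1 * v0 + ratr c.2 * v1.
  have [Vv|nVv] := pselect (V v); last by exists (0, 0).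
  have [a [b E]] := space_coordinates hV (Vs _ v0s) (Vs _ (sub _ v1s)) i01 Vv.
  by exists (a, b).
have [co {}coordE] := choice coordE.
pose a v := (co v).1; pose b v := (co v).2.
have coE v : v \in s -> v = (ratr (a v) : R)%:C * v0 + (ratr (b v) : R)%:C * v1.
  by move=> vs; rewrite -!ratr_complex; apply/coordE/Vs/sub.
have cross0 v : v \in s -> cross v0 v = ratr (b v) * cross v0 v1.
  by move=> vs; rewrite {1}(coE v vs) crossD !crossZ crossvv mulr0 add0r.
have cross1 v : v \in s -> cross v1 v = - (ratr (a v) * cross v0 v1).
  move=> vs; rewrite {1}(coE v vs) crossD !crossZ crossvv /cross; ring.
have b0 : {in s, forall v, b v != 0}.
  move=> v vs; have [/R_independentP] := ang _ _ v0s (sub _ vs) (s_neq _ vs).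
  by rewrite cross0 // mulf_eq0 negb_or fmorph_eq0 => /andP[].
have ab12 : a v1 / b v1 != a v2 / b v2.
  have v12 : v1 != v2.
    by move: us; rewrite /= !inE !negb_or; case/and3P => _ /andP[].
  have [/R_independentP] := ang _ _ (sub _ v1s) (sub _ v2s) v12.
  have /eqP := cross1 v1 v1s; rewrite crossvv eq_sym oppr_eq0 mulf_eq0.
  rewrite (negbTE D0) orbF fmorph_eq0 => /eqP ->.
  rewrite cross1 // oppr_eq0 mulf_eq0 fmorph_eq0 negb_or => /andP[a2 _].
  by rewrite mul0r eq_sym mulf_neq0 ?invr_eq0 ?b0.
have [c [q0 [s1 [s2 [ps q0a q0n q0p sum0]]]]] :
  exists c (q : R[i] -> rat) s1 s2,
  [/\ perm_eq (s1 ++ s2) s, {in s, forall v, 0 < q v * (a v - c * b v)},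
      {in s1, forall v, q v * b v < 0}, {in s2, forall v, 0 < q v * b v} &
      \sum_(v <- s1 ++ s2) q v * b v = 0].
  move: ab12; rewrite neq_lt => /orP[|] /(balanced_weights b0); exact.
(* The weight of [v0] is forced by the vanishing of the total. *)
pose q v := if v == v0 then - \sum_(v <- s1 ++ s2) q0 v * a v else q0 v.
pose t := s1 ++ s2 ++ [:: v0].
have pt : perm_eq t (v0 :: s).
  by rewrite /t catA cats1 perm_rcons perm_cons.
have s12 v : v \in s1 ++ s2 -> v \in s by rewrite (perm_mem ps).
have qE v : v \in s1 ++ s2 -> q v = q0 v.
  by move=> /s12 /s_neq; rewrite /q eq_sym => /negbTE ->.
(* The total height is zero, so the shear does not change the total abscissa,
   which is therefore positive. *)
have qv0 : q v0 = - \sum_(v <- s1 ++ s2) q0 v * (a v - c * b v).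
  rewrite /q eqxx; congr (- _).
  rewrite [RHS](eq_bigr (fun v => q0 v * a v - c * (q0 v * b v))); last first.
    by move=> v _; ring.
  by rewrite sumrB -mulr_sumr sum0 mulr0 subr0.
have sz12 : size (s1 ++ s2) = m.+2.
  by rewrite (perm_size ps) /=; case: szs => ->.
have q_neq0 : {in t, forall v, q v != 0}.
  move=> v; rewrite /t catA mem_cat inE => /orP[vs|/eqP->].
    rewrite qE //; apply: contraTneq (q0a v (s12 _ vs)) => ->.
    by rewrite mul0r ltxx.
  rewrite qv0 oppr_eq0 gt_eqF // sumr_gt0 ?sz12 // => w /s12; exact: q0a.
pose f v : R[i] := ratr (q v) * v.
pose e := map f t.
have eE : e = map f s1 ++ map f s2 ++ [:: f v0] by rewrite /e !map_cat.
have sze : size e = m.+3 by rewrite size_map (perm_size pt).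
have sume : \sum_(x <- e) x = 0.
  rewrite big_map /t catA big_cat big_seq1 /= /f.
  rewrite (eq_big_seq (fun v =>
      ratr (q0 v * a v) * v0 + ratr (q0 v * b v) * v1)).
    rewrite big_split /= -!mulr_suml -!rmorph_sum sum0 rmorph0 mul0r addr0.
    by rewrite /q eqxx rmorphN mulNr subrr.
  move=> v vs; rewrite qE // {2}(coE v (s12 _ vs)) -!ratr_complex !rmorphM /=.
  ring.
pose p := fun k : 'I_m.+3 => \sum_(x <- take k e) x.
have sideE (i : 'I_m.+3) : side p i = f t`_i.
  by rewrite /p side_psum // (nth_map 0) // (perm_size pt) szs.
exists p.
have [] := @rational_angles_of_proportional_sides R m.+3 t q p => //.
- by rewrite (perm_uniq pt).
- by rewrite (perm_size pt).
- by move=> v w; rewrite !(perm_mem pt); apply: ang.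
move=> pang ppar; split=> //.
(* [cross u] and [cross w] are the dual basis of [v0] and [v1 + c v0], i.e. the
   sheared abscissa and the height. *)
- pose u := (- (cross v0 v1)^-1)%:C * (v1 + (ratr c : R)%:C * v0).
  pose w := ((cross v0 v1)^-1)%:C * v0.
  have uE v : v \in s -> cross u (f v) = ratr (q v * (a v - c * b v)).
    move=> vs; rewrite /f /u ratr_complex crossZ crossZl crossDl crossZl.
    rewrite (cross1 v) // (cross0 v) // rmorphM rmorphB rmorphM /=.
    by field.
  have wE v : v \in s -> cross w (f v) = ratr (q v * b v).
    move=> vs; rewrite /f /w ratr_complex crossZ crossZl (cross0 v) // rmorphM.
    by rewrite /=; field.
  rewrite /p eE; apply: (@simple_polygon_psum _ _ _ _ _ u w); rewrite -?eE //.
  + move=> x; rewrite -map_cat => /mapP[v vs ->].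
    by rewrite uE ?s12 // qE // ltr0q q0a ?s12.
  + move=> x /mapP[v vs ->]; have vs12 : v \in s1 ++ s2 by rewrite mem_cat vs.
    by rewrite wE ?s12 // qE // ltrq0 q0n.
  + move=> x /mapP[v vs ->].
    have vs12 : v \in s1 ++ s2 by rewrite mem_cat vs orbT.
    by rewrite wE ?s12 // qE // ltr0q q0p.
  + by rewrite /f /w ratr_complex crossZ crossZl crossvv !mulr0.
- move=> i; apply: space_sum => // x /mem_take /mapP[v].
  rewrite (perm_mem pt) => vs ->.
  rewrite /f -[_ * v]addr0 -[0](mul0r v) -(rmorph0 ratr).
  by apply: space_subspace => //; exact: Vs.
Qed.

(** * From polygons to tuples *)

(** Independence makes the sides distinct and nonzero; each is a rational angle
    away from the first one, by induction along the boundary. *)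
Lemma tuple_of_polygon (R : realType) (V : set R[i]) (n : nat)
    (p : 'I_n -> R[i]) :
    is_space V -> (forall i, V (p i)) -> (forall i, rational_angle_at p i) ->
    no_parallel_sides p ->
  exists S : {fset R[i]}, rational_tuple V n S.
Proof.
move=> hV Vp ang par.
have side_inj : injective (side p).
  move=> i j E; apply/eqP/contraT => /par /R_independent_neq.
  by rewrite E eqxx.
have Vside i : V (side p i).
  have -> : side p i = ratr 1 * p (ordS i) + ratr (- 1) * p i.
    by rewrite rmorphN !rmorph1 mulNr !mul1r.
  exact: space_subspace.
exists [fset side p i | i : 'I_n]%fset; split.
- by move=> z /= /imfsetP[i _ ->].
- by rewrite card_imfset //= -cardE card_ord.
move=> _ _ /imfsetP[i _ ->] /imfsetP[j _ ->] ij; split=> //.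
  by apply: par; apply: contraNneq ij => ->.
have {ij} ij : i != j by apply: contraNneq ij => ->.
have side_neq0 k : side p k != 0.
  have [->|kj] := eqVneq k j; last exact: R_independent_neq0 (par _ _ kj).
  by apply: (@R_independent_neq0 _ _ (side p i)); apply: par; rewrite eq_sym.
have n0 : (0 < n)%N by apply: leq_ltn_trans (ltn_ord i).
pose o := Ordinal n0.
have step k : rational_argument (side p k / side p (ord_pred k)).
  have := ang k; rewrite /rational_angle_at.
  have -> : p (ord_pred k) - p k = - side p (ord_pred k).
    by rewrite /side ord_predK opprB.
  by rewrite invrN mulrN => /rational_argumentN; rewrite opprK.
have chain k (kn : (k < n)%N) :
    rational_argument (side p (Ordinal kn) / side p o).
  elim: k kn => [|k IH] kn.
    have -> : Ordinal kn = o by apply/val_inj.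
    rewrite divff // -(rmorph1 ratr).
    by apply: rational_argument_ratr; rewrite oner_eq0.
  have pk : ord_pred (Ordinal kn) = Ordinal (ltnW kn).
    by apply/val_inj; rewrite /= modnDr modn_small // ltnW.
  have -> : side p (Ordinal kn) / side p o =
      side p (Ordinal kn) / side p (ord_pred (Ordinal kn)) *
      (side p (Ordinal (ltnW kn)) / side p o).
    by rewrite mulrA pk divfK.
  exact: rational_argumentM.
have -> : side p i / side p j =
    (side p i / side p o) * (side p j / side p o)^-1.
  by rewrite invfM invrK mulrA mulrAC divfK // mulrC.
apply: rational_argumentM; last apply: rational_argumentV.
  have := chain i (ltn_ord i); congr (rational_argument (side p _ / _)).
  exact/val_inj.
have := chain j (ltn_ord j); congr (rational_argument (side p _ / _)).
exact/val_inj.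
Qed.

Theorem proposition0p1 (R : realType) (V : set R[i]) (n : nat)
    (hV : is_space V) (hn : (3 <= n)%N) :
  (exists S : {fset R[i]}, rational_tuple V n S) <->
  (exists p : 'I_n -> R[i],
     [/\ simple_polygon p,
         (forall i, V (p i)),
         (forall i, rational_angle_at p i) &
         no_parallel_sides p]).
Proof.
split=> [[S]|[p [_ Vp ang par]]]; last exact: tuple_of_polygon Vp ang par.
by case: n hn => [|[|[|m]]] // _; apply: polygon_of_tuple.
Qed.
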